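(* Let $G$ be a finite non-nilpotent soluble group with $\sigma(G)=\mathfrak{m}(G)$, and write $\sigma=\sigma(G)$. Then $\sigma\neq 3$ and there are a prime $p$ and an integer $\alpha>0$ such that $G/\Phi(G)\cong E_{\sigma-1}\rtimes \mathbb{Z}_{p^{\alpha}}$, where $\mathbb{Z}_{p^{\alpha}}$ acts faithfully on $E_{\sigma-1}$.
   Context: For a finite non-cyclic group $G$, $\mathfrak{m}(G)$ is the number of maximal subgroups of $G$, and $\sigma(G)$ is the least positive integer $n$ such that $G$ is the union of $n$ proper subgroups. $\Phi(G)$ is the Frattini subgroup. $E_n$ denotes an elementary abelian group of order $n$ (so in particular $n$ is a prime power), and $\mathbb{Z}_n$ the cyclic group of order $n$. *)

(* Defs.v *)
From mathcomp Require Import all_boot all_fingroup all_solvable.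
Set Implicit Arguments.
Unset Strict Implicit.
Unset Printing Implicit Defensive.
Local Open Scope group_scope.

Definition proper_cover (gT : finGroupType) (G : {group gT})
    (C : {set {group gT}}) : bool :=
  [forall (H : {group gT} | H \in C), H \proper G]
    && (\bigcup_(H in C) H == G :> {set gT}).

(* If G is cyclic it has no proper cover and the value is meaningless;
   otherwise the family of all proper subgroups is a proper cover, and
   covering_numberP says that the value is the intended minimum. *)
Definition covering_number (gT : finGroupType) (G : {group gT}) : nat :=
  #|[arg min_(C < [set H : {group gT} | H \proper G] | proper_cover G C) #|C| ]|.

Definition num_maximal (gT : finGroupType) (G : {group gT}) : nat :=
  #|[set M : {group gT} | maximal M G]|.

Lemma all_proper_cover (gT : finGroupType) (G : {group gT}) :
  ~~ cyclic G -> proper_cover G [set H : {group gT} | H \proper G].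
Proof.
move=> ncG; apply/andP; split.
  by apply/forall_inP => H; rewrite inE.
rewrite eqEsubset; apply/andP; split.
  by apply/bigcupsP => H; rewrite inE; apply: proper_sub.
apply/subsetP => x Gx; apply/bigcupP; exists <[x]>%G; last exact: cycle_id.
rewrite inE properEneq cycle_subG Gx andbT.
by apply: contra ncG => /eqP <-; apply: cycle_cyclic.
Qed.

(* The number of subgroups may be counted with or without repetition. *)
Lemma covering_numberP (gT : finGroupType) (G : {group gT}) :
  ~~ cyclic G ->
  (exists H : 'I_(covering_number G) -> {group gT},
     (forall i, H i \proper G) /\ \bigcup_i H i = G :> {set gT}) /\
  (forall (n : nat) (H : 'I_n -> {group gT}),
     (forall i, H i \proper G) -> \bigcup_i H i = G :> {set gT} ->
     covering_number G <= n).
Proof.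
move=> ncG; rewrite /covering_number.
case: arg_minnP => [|C /andP[/forall_inP prC /eqP defG] minC].
  exact: all_proper_cover.
split.
  exists (@enum_val _ (mem C)); split=> [i|].
    exact/prC/enum_valP.
  by rewrite -[RHS]defG [RHS]big_enum_val.
move=> n H prH defH.
apply: (@leq_trans #|[set H i | i : 'I_n]|).
  apply: minC; apply/andP; split.
    by apply/forall_inP => _ /imsetP[i _ ->].
  rewrite -defH eqEsubset; apply/andP; split.
    by apply/bigcupsP => _ /imsetP[i _ ->]; apply: (bigcup_sup i).
  by apply/bigcupsP => i _; apply: (bigcup_sup (H i)); rewrite ?imset_f.
by rewrite (leq_trans (leq_imset_card _ _)) // card_ord.
Qed.

(* Main.v *)
(** Replacing the members of a cover by maximal subgroups, sigma(G) = m(G) means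
    that every maximal subgroup contains an element lying in no other maximal
    subgroup.  Since G is not nilpotent it has a nonnormal maximal subgroup M;
    let K be its core, so that G/K is primitive and G/K = V ><| (M/K) with V
    minimal normal.  A private element of M/K generates it (if it generated L
    strictly below M/K it would also lie in a maximal subgroup containing VL),
    so M/K is cyclic and G/K is a Frobenius group.  Elements outside V lie in
    conjugates of M/K, hence a maximal subgroup other than these has its private
    elements in V; thus only one maximal subgroup contains V, which forces M/K
    to be a p-group, and G/K has exactly |V| + 1 maximal subgroups.  As
    G/K is not cyclic, the maximal subgroups of G above K already cover G, so
    they are all of them, and K is the Frattini subgroup.  Finally |V| = 2 would
    make M/K trivial. *)
Require Import Defs.
From mathcomp Require Import all_boot all_fingroup all_solvable.
Set Implicit Arguments.
Unset Strict Implicit.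
Unset Printing Implicit Defensive.
Local Open Scope group_scope.

(** * Nilpotency criterion and soluble primitive groups *)

(** If the normaliser in [G] of a Sylow subgroup [P] lay in a maximal [M], the Frattini argument in
    the normal subgroup [M] would give G = M N_G(P) = M. So every Sylow subgroup is normal and lies
    in the Fitting subgroup, and together they generate [G]. *)
Lemma nilpotent_normal_maximal (gT : finGroupType) (G : {group gT}) :
  (forall M : {group gT}, maximal M G -> M <| G) -> nilpotent G.
Proof.
move=> nsMG; apply: nilpotentS (Fitting_nil G); rewrite -{1}(Sylow_gen G).
rewrite gen_subG; apply/bigcupsP=> P /SylowP[p _ sylP].
have sPG := pHall_sub sylP.
apply: Fitting_max (pgroup_nil (pHall_pgroup sylP)); rewrite /normal sPG /=.
have [<-|[M maxM sNM]] := maximal_exists (subsetIl G 'N(P)).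
  exact: subsetIr.
have prMG := maxgroupp maxM; have sMG := proper_sub prMG.
case/negP: (proper_subn prMG).
have sPM: P \subset M by rewrite (subset_trans _ sNM) // subsetI sPG normG.
by rewrite -(Frattini_arg (nsMG M maxM) (pHall_subl sPM sMG sylP)) mul_subG.
Qed.

Lemma primitive_solvable_sdprod (gT : finGroupType) (G M : {group gT}) :
    solvable G -> maximal M G -> gcore M G = 1 ->
  exists V : {group gT},
    [/\ minnormal V G, is_abelem V, V ><| M = G & 'C_M(V) = 1].
Proof.
move=> solG maxM coreM.
have prMG := maxgroupp maxM; have sMG := proper_sub prMG.
have ntG: G :!=: 1 by rewrite -proper1G (sub_proper_trans (sub1G M)).
have [V minV sVG] := minnormal_exists ntG (normG G).
have [nVG ntV abelV] := minnormal_solvable minV sVG solG.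
have cVV: abelian V by have /is_abelemP[p _ /abelem_abelian] := abelV.
have nVM := subset_trans sMG nVG.
have not_sVM: ~~ (V \subset M).
  by apply: contra ntV => sVM; rewrite -subG1 -coreM gcore_max.
have defG: V * M = G.
  rewrite -norm_joinEr //; apply/eqP; rewrite eqEproper join_subG sVG sMG /=.
  apply: contra not_sVM => prVM; have /maxgroupP[_ maxMP] := maxM.
  by rewrite -(maxMP _ prVM) ?joing_subl ?joing_subr.
(* Both [V :&: M] and ['C_M(V)] lie in [M] and are normalised by [V] and [M], hence by [V * M = G],
   so the trivial core contains them. *)
have trivM (A : {group gT}) :
    A \subset M -> V \subset 'N(A) -> M \subset 'N(A) -> A :=: 1.
  move=> sAM nAV nAM; apply/trivgP; rewrite -coreM gcore_max // -defG.
  exact: mul_subG.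
exists V; split=> //.
  rewrite sdprodE // setIC; apply: trivM; first exact: subsetIl.
    by rewrite cents_norm // centsC (subset_trans (subsetIr _ _)).
  by rewrite normsI ?normG.
apply: trivM; first exact: subsetIl.
  by rewrite cents_norm // centsC subsetIr.
by rewrite normsI ?normG // norms_cent.
Qed.

(* For noncyclic groups this is equivalent to [covering_number G = num_maximal G]. *)
Definition irredundant_maximals (gT : finGroupType) (G : {group gT}) :=
  forall M : {group gT}, maximal M G ->
    exists2 x, x \in M
      & forall N : {group gT}, maximal N G -> x \in N -> N = M.

(** * Primitive groups whose maximal subgroups all have private elements *)

Section PrimitiveIrredundant.

Variables (gT : finGroupType) (G M V : {group gT}).
Hypotheses (irrG : irredundant_maximals G) (maxM : maximal M G).
Hypotheses (nsMG : ~~ (M <| G)) (minV : minnormal V G) (abelV : is_abelem V).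
Hypotheses (defG : V ><| M = G) (cMV : 'C_M(V) = 1).

Let sMG : M \subset G := proper_sub (maxgroupp maxM).
Let sVG : V \subset G.
Proof. by case/sdprod_context: defG => /andP[]. Qed.
Let nVM : M \subset 'N(V).
Proof. by case/sdprodP: defG. Qed.
Let tiVM : V :&: M = 1.
Proof. by case/sdprodP: defG. Qed.
Let defVM : V * M = G.
Proof. exact: sdprodW defG. Qed.
Let ntV : V :!=: 1.
Proof. by case/andP: (mingroupp minV). Qed.
Let cVV : abelian V.
Proof. by have /is_abelemP[p _ /abelem_abelian] := abelV. Qed.
Let ntM : M :!=: 1.
Proof. by apply: contra nsMG => /eqP->; rewrite normal1. Qed.

Let not_sVM : ~~ (V \subset M).
Proof. by apply: contra ntV => /setIidPl <-; rewrite tiVM. Qed.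

Let sub_maximalM (L : {group gT}) :
  L \proper M -> exists2 N : {group gT}, maximal N G & V <*> L \subset N.
Proof.
move=> prLM; have [sLM _] := andP prLM.
have sLG := subset_trans sLM sMG.
have sVLG: V <*> L \subset G by rewrite join_subG sVG.
have [/= VLG | //] := maximal_exists sVLG; case/negP: (proper_subn prLM).
(* By the modular law [M] meets [V * L] in [L], so [V * L = G] would force [L = M]. *)
have := congr1 (setI M) VLG; rewrite /= norm_joinEr ?(subset_trans sLM) //.
by rewrite -group_modr // [M :&: V]setIC tiVM mul1g (setIidPl sMG) => ->.
Qed.

Lemma primitive_compl_cyclic : cyclic M.
Proof.
have [x Mx uniqM] := irrG maxM; apply/cyclicP; exists x; apply/eqP.
rewrite eq_sym eqEproper cycle_subG Mx /=; apply/negP=> /sub_maximalM[N maxN].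
rewrite join_subG cycle_subG => /andP[sVN Nx].
by case/negP: not_sVM; rewrite -(uniqM N maxN Nx).
Qed.

(** Since [M] and [V] are abelian, ['C_V[m]] is normalised by [V * M = G]. By minimality it is 1 or
    [V], and ['C_M(V) = 1] excludes [V] when [m] is nontrivial. *)
Lemma primitive_Frobenius : [Frobenius G = V ><| M].
Proof.
apply/Frobenius_semiregularP=> // m /setD1P[ntm Mm].
have cMM := cyclic_abelian primitive_compl_cyclic.
apply/eqP; apply: contraR ntm => ntC; have /mingroupP[_ minVP] := minV.
have defC: 'C_V[m] = V.
  apply: minVP (subsetIl _ _); rewrite ntC -defVM mul_subG //.
    by rewrite (sub_abelian_norm cVV) ?subsetIl.
  by rewrite normsI // (subset_trans _ (normG _)) // sub_cent1 (subsetP cMM).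
rewrite -in_set1 -[[set 1]]cMV inE Mm -sub_cent1; exact/setIidPl.
Qed.

Lemma primitive_memJ_compl y : y \in G -> y \notin V ->
  exists2 v, v \in V & y \in M :^ v.
Proof.
move=> Gy notVy; have /and3P[/eqP defP _ _] := Frobenius_partition primitive_Frobenius.
move: Gy; rewrite -defP => /bigcupP[B /setU1P[-> | /imsetP[v Vv ->]] yB].
  by rewrite yB in notVy.
by exists v => //; move: yB; rewrite conjD1g => /setD1P[].
Qed.

Let maxMJ v : v \in G -> maximal (M :^ v)%G G.
Proof. by move=> Gv; have := maxM; rewrite -(maximalJ M G v) /= (conjGid Gv). Qed.

Let not_sVMJ v : v \in V -> ~~ (V \subset M :^ v).
Proof. by move=> Vv; rewrite -sub_conjgV conjGid ?groupV. Qed.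

Let maximal_notin_kernel (N : {group gT}) y :
    maximal N G -> y \in N ->
    (forall L : {group gT}, maximal L G -> y \in L -> L = N) ->
  y \notin V -> exists2 v, v \in V & N = (M :^ v)%G.
Proof.
move=> maxN Ny uniqN notVy.
have Gy := subsetP (proper_sub (maxgroupp maxN)) y Ny.
have [v Vv Mvy] := primitive_memJ_compl Gy notVy.
by exists v; last apply/esym/uniqN/Mvy/maxMJ/(subsetP sVG).
Qed.

(** A private element of [N] outside [V] would make [N] a conjugate of [M], which cannot contain
    [V]. Inside [V], it lies in every maximal subgroup over [V]. *)
Lemma primitive_maximal_over_kernel :
  exists2 N : {group gT}, maximal N G /\ V \subset N
    & forall L : {group gT}, maximal L G -> V \subset L -> L = N.
Proof.
have [|N maxN] := @sub_maximalM 1%G; first by rewrite proper1G.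
rewrite joingG1 => sVN; exists N => // L maxL sVL.
have [y Ny uniqN] := irrG maxN.
have [Vy|/(maximal_notin_kernel maxN Ny uniqN)[v Vv defN]] := boolP (y \in V).
  exact/uniqN/(subsetP sVL).
by have := not_sVMJ Vv; rewrite -[M :^ v]/(gval (M :^ v)%G) -defN sVN.
Qed.

Lemma primitive_compl_pgroup : exists2 p, prime p & p.-group M.
Proof.
have [N [maxN sVN] uniqN] := primitive_maximal_over_kernel.
have ltNG := maxgroupp maxN.
have sub_N (L : {group gT}) : L \proper M -> L \subset N.
  case/sub_maximalM=> K maxK; rewrite join_subG => /andP[sVK sLK].
  by rewrite -(uniqN K maxK sVK).
have p_pr: prime (pdiv #|M|) by rewrite pdiv_prime ?cardG_gt1.
exists (pdiv #|M|) => //; set p := pdiv _ in p_pr *.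
have nilM := abelian_nil (cyclic_abelian primitive_compl_cyclic).
have [_ defM _ _] := dprodP (nilpotent_pcoreC p nilM).
(* If [M] is not a p-group, its p-core and p'-core are both proper in [M], so [N] contains both, and
   with them [V * M = G]. *)
apply: contraT => not_pM; case/negP: (proper_subn ltNG).
rewrite -defVM mul_subG // -defM mul_subG // sub_N // properEneq pcore_sub andbT.
  by apply: contra not_pM => /eqP <-; apply: pcore_pgroup.
apply: contraTneq (pcore_pgroup p^' M) => ->.
by rewrite p'groupEpi mem_primes p_pr cardG_gt0 pdiv_dvd.
Qed.

Lemma primitive_num_maximal : num_maximal G = #|V|.+1.
Proof.
have [N [maxN sVN] uniqN] := primitive_maximal_over_kernel.
have defMax : [set L : {group gT} | maximal L G]
    = N |: [set (M :^ v)%G | v in V].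
  apply/setP=> L; rewrite !inE; apply/idP/predU1P=> [maxL | [-> // |]]; last first.
    by case/imsetP=> v Vv ->; rewrite maxMJ ?(subsetP sVG).
  have [y Ly uniqL] := irrG maxL.
  have [Vy | notVy] := boolP (y \in V); last first.
    have [v Vv ->] := maximal_notin_kernel maxL Ly uniqL notVy.
    by right; apply: imset_f.
  by left; rewrite (uniqL N) ?(subsetP sVN).
have notMN: N \notin [set (M :^ v)%G | v in V].
  apply/imsetP=> [[v Vv defN]]; have := not_sVMJ Vv.
  by rewrite -[M :^ v]/(gval (M :^ v)%G) -defN sVN.
rewrite /num_maximal defMax cardsU1 notMN card_in_imset // => v w Vv Vw eqM.
(* If [v] and [w] give the same conjugate, [v * w^-1] normalises [M], so it lies in [M], which is
   maximal and not normal; it also lies in [V], hence is 1. *)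
apply/eqP; rewrite eq_mulgV1 -in_set1 -[[set 1]]tiVM inE groupM ?groupV //=.
have /(congr1 val)/= eqMvw := eqM.
have: v * w^-1 \in 'N_G(M).
  rewrite inE groupM ?groupV ?(subsetP sVG) //=.
  by apply/normP; rewrite conjsgM eqMvw conjsgK.
suffices ->: 'N_G(M) = M by [].
have /maxgroupP[_ maxMP] := maxM; apply: maxMP.
  rewrite properEneq subsetIl andbT; apply: contra nsMG => /eqP/setIidPl.
  by rewrite /normal sMG.
by rewrite subsetI sMG normG.
Qed.

End PrimitiveIrredundant.

(** * Covers by maximal subgroups *)

Lemma mem_maximal_noncyclic (gT : finGroupType) (G : {group gT}) x :
  ~~ cyclic G -> x \in G -> exists2 M : {group gT}, maximal M G & x \in M.
Proof.
move=> ncG; rewrite -cycle_subG => /maximal_exists[/= defG | [M maxM]].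
  by rewrite -defG cycle_cyclic in ncG.
by rewrite cycle_subG; exists M.
Qed.

Lemma covering_number_min (gT : finGroupType) (G : {group gT})
    (C : {set {group gT}}) :
  ~~ cyclic G -> proper_cover G C -> covering_number G <= #|C|.
Proof.
move=> ncG covC; rewrite /covering_number.
by case: arg_minnP => [|D _]; [apply: all_proper_cover | apply].
Qed.

(** The maximal subgroups satisfying [P] form a proper cover, so they number at least sigma(G) =
    m(G) and are all of the maximal subgroups. *)
Lemma maximal_cover_full (gT : finGroupType) (G : {group gT})
    (P : pred {group gT}) :
    ~~ cyclic G -> covering_number G = num_maximal G ->
    (forall x, x \in G ->
       exists M : {group gT}, [/\ maximal M G, P M & x \in M]) ->
  forall M : {group gT}, maximal M G -> P M.
Proof.
move=> ncG cnG covP M maxM.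
pose C := [set N : {group gT} | maximal N G & P N].
have sCmax : C \subset [set N : {group gT} | maximal N G].
  by apply/subsetP=> N; rewrite !inE => /andP[].
have covC : proper_cover G C.
  apply/andP; split.
    by apply/forall_inP=> N; rewrite inE => /andP[/maxgroupp].
  rewrite eqEsubset; apply/andP; split.
    by apply/bigcupsP=> N; rewrite inE => /andP[/maxgroupp/proper_sub].
  apply/subsetP=> x /covP[N [maxN PN Nx]]; apply/bigcupP; exists N => //.
  by rewrite inE maxN.
have /eqP defC : C == [set N : {group gT} | maximal N G].
  by rewrite eqEcard sCmax -/(num_maximal G) -cnG covering_number_min.
have: M \in C by rewrite defC inE.
by rewrite inE => /andP[].
Qed.

Lemma covering_number_irredundant (gT : finGroupType) (G : {group gT}) :
  ~~ cyclic G -> covering_number G = num_maximal G -> irredundant_maximals G.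
Proof.
move=> ncG cnG M maxM.
have [/exists_inP[x Mx /forall_inP uniqx] | noM] := boolP
    [exists x in M, [forall (N : {group gT} | maximal N G), (x \in N) ==> (N == M)]].
  by exists x => // N maxN Nx; apply/eqP/(implyP (uniqx N maxN)).
(* If [M] has no private element, the other maximal subgroups still cover [G]. *)
suffices /(_ M maxM) : forall N : {group gT}, maximal N G -> N != M by rewrite eqxx.
apply: (maximal_cover_full (P := fun N => N != M) ncG cnG) => x Gx.
have [Mx | notMx] := boolP (x \in M).
  move: noM; rewrite negb_exists_in => /forall_inP/(_ x Mx).
  rewrite negb_forall_in => /exists_inP[N maxN]; rewrite negb_imply => /andP[Nx neNM].
  by exists N.
have [N maxN Nx] := mem_maximal_noncyclic ncG Gx.
by exists N; split=> //; apply: contraNneq notMx => <-.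
Qed.

(** * Passage to quotients *)

(** A private element of the preimage of [M] maps to a private element of [M], since preimages of
    maximal subgroups are maximal. *)
Lemma irredundant_quotient (gT : finGroupType) (G K : {group gT}) :
  K <| G -> irredundant_maximals G -> irredundant_maximals (G / K).
Proof.
move=> nsKG irrG M; rewrite -cosetpre_maximal quotientGK // => maxM.
have [x Mx uniqx] := irrG _ maxM.
have Nx : x \in 'N(K) by case/morphpreP: Mx.
exists (coset K x) => [|N maxN NKx]; first by case/morphpreP: Mx.
suffices /(congr1 val)/= eqNM : (coset K @*^-1 N)%G = (coset K @*^-1 M)%G.
  by apply: val_inj; rewrite /= -(cosetpreK N) eqNM cosetpreK.
apply: uniqx; last exact/morphpreP.
by rewrite -(quotientGK nsKG) cosetpre_maximal.
Qed.

Lemma num_maximal_quotient (gT : finGroupType) (G K : {group gT}) :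
    K <| G -> (forall M : {group gT}, maximal M G -> K \subset M) ->
  num_maximal (G / K) = num_maximal G.
Proof.
move=> nsKG sKmax; rewrite /num_maximal.
have nsK (M : {group gT}) : maximal M G -> K <| M.
  move=> maxM; apply: normalS nsKG; first exact: sKmax.
  exact: proper_sub (maxgroupp maxM).
rewrite -(@card_in_imset _ _ (fun M : {group gT} => (M / K)%G)) => [|M N]; last first.
  rewrite !inE => maxM maxN /(congr1 val)/= eqMN; apply: val_inj => /=.
  by rewrite -(quotientGK (nsK M maxM)) eqMN quotientGK ?nsK.
congr #|pred_of_set _|; apply/setP=> Q; rewrite inE; apply/idP/imsetP=> [maxQ | [M]].
  exists (coset K @*^-1 Q)%G; last by apply: val_inj; rewrite /= cosetpreK.
  by rewrite inE -(quotientGK nsKG) cosetpre_maximal.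
by rewrite inE => maxM ->; rewrite quotient_maximal // nsK.
Qed.

(** The preimage of the core of the quotient lies in [M] and is normalised by [G], hence lies in the
    core of [M]. *)
Lemma quotient_gcore (gT : finGroupType) (G M : {group gT}) :
  M \subset G -> gcore (M / gcore M G) (G / gcore M G) = 1.
Proof.
move=> sMG; set K := gcore M G; set A := gcore _ _.
have nsKG : K <| G := gcore_normal sMG.
have nsKM : K <| M by apply: normalS nsKG => //; apply: gcore_sub.
have sAM : coset K @*^-1 A \subset M.
  by rewrite -(quotientGK nsKM) cosetpreSK gcore_sub.
have sAK : coset K @*^-1 A \subset K.
  apply: gcore_max => //; rewrite -{1}(quotientGK nsKG).
  exact: subset_trans (morphpre_norms _ (gcore_norm _ _)) (subxx _).
by apply/trivgP; have := quotientS K sAK; rewrite trivg_quotient cosetpreK.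
Qed.

(** * The core as Frattini subgroup, and the structure of the quotient *)

Theorem lemma2p3 (gT : finGroupType) (G : {group gT}) :
  solvable G -> ~~ nilpotent G -> covering_number G = num_maximal G ->
  covering_number G <> 3 /\
  exists (p alpha : nat) (E Z : {group coset_of 'Phi(G)}),
    [/\ prime p, 0 < alpha & E ><| Z = G / 'Phi(G)] /\
    [/\ is_abelem E, #|E| = (covering_number G - 1)%N,
        cyclic Z, #|Z| = (p ^ alpha)%N & [faithful Z, on E | 'J]].
Proof.
move=> solG not_nilG cnG.
have ncG : ~~ cyclic G by apply: contra not_nilG => /cyclic_abelian/abelian_nil.
have irrG := covering_number_irredundant ncG cnG.
have /exists_inP[M maxM nsMG] :
    [exists (M : {group gT} | maximal M G), ~~ (M <| G)].
  apply: contraR not_nilG; rewrite negb_exists_in => /forall_inP nsG.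
  by apply: nilpotent_normal_maximal => M /nsG/negPn.
have sMG := proper_sub (maxgroupp maxM).
pose K := [group of gcore M G].
have nsKG : K <| G := gcore_normal sMG.
have nsKM : K <| M by apply: normalS nsKG => //; apply: gcore_sub.
have maxMK : maximal (M / K) (G / K) by rewrite quotient_maximal.
have nsMK : ~~ (M / K <| G / K).
  by apply: contra nsMG; rewrite -cosetpre_normal !quotientGK.
have ncGK : ~~ cyclic (G / K).
  apply: contra nsMK => /cyclic_abelian cGK.
  by rewrite -sub_abelian_normal // quotientS.
(* The preimages of the maximal subgroups of the noncyclic [G / K] cover [G]. *)
have sKmax (N : {group gT}) : maximal N G -> K \subset N.
  move: N; apply: (maximal_cover_full (P := fun N => K \subset N) ncG cnG) => x Gx.
  have [N maxN Nx] := mem_maximal_noncyclic ncGK (mem_quotient K Gx).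
  exists (coset K @*^-1 N)%G; split; last 2 first.
  - exact: sub_cosetpre.
  - by rewrite mem_morphpre // (subsetP (normal_norm nsKG)).
  by rewrite -(quotientGK nsKG) cosetpre_maximal.
have -> : 'Phi(G) = K.
  apply/eqP; rewrite eqEsubset /= gcore_max ?Phi_sub_max ?normal_norm ?Phi_normal //.
  apply/bigcapsP=> N /predU1P[-> | /sKmax //]; exact: normal_sub nsKG.
have numMK := num_maximal_quotient nsKG sKmax.
have [V [minV abelV defGK cMV]] :=
  primitive_solvable_sdprod (quotient_sol K solG) maxMK (quotient_gcore sMG).
have irrGK := irredundant_quotient nsKG irrG.
have cycM := primitive_compl_cyclic irrGK maxMK minV defGK.
have frobGK := primitive_Frobenius irrGK maxMK nsMK minV abelV defGK cMV.
have ntMK : M / K != 1 by case: (Frobenius_context frobGK).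
have [p p_pr pM] := primitive_compl_pgroup irrGK maxMK nsMK minV abelV defGK cMV.
have := primitive_num_maximal irrGK maxMK nsMK minV abelV defGK cMV.
rewrite numMK -cnG => cardV; split.
  (* The order of a Frobenius complement divides [#|V| - 1], which is 1 if sigma is 3. *)
  rewrite cardV => -[] cardV2; have := Frobenius_dvd_ker1 frobGK.
  by rewrite cardV2 dvdn1 -trivg_card1 (negPf ntMK).
have [n cardM] := p_natP pM.
exists p, n, V, (M / K)%G; rewrite cardV subn1 /=; split; split=> //.
  by rewrite lt0n; apply: contraNneq ntMK => n0; rewrite trivg_card1 cardM n0.
by rewrite /faithful astabJ cMV.
Qed.
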